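(* Let $S=S(\ell_1,\ldots,\ell_k)$ be a spider on $n$ vertices, with split vertex $w$ and leaves $v_1,\ldots,v_k$. Suppose that $r$ is a positive integer with $r\le\sqrt{n\ln 2}-(\ln 2)/2$. Then $S$ is $r$-EKR.
   Context: A split vertex of a graph is a vertex of degree at least 3. A spider is a tree with exactly one split vertex; for a spider with split vertex $w$ and leaves $v_1,\ldots,v_k$ one writes $S=S(\ell_1,\ldots,\ell_k)$ where $\ell_i$ is the distance from $w$ to $v_i$. For a graph $G$, $\mathcal{I}^r(G)$ denotes the family of independent sets of $G$ of size exactly $r$, and $s_r(v)$ denotes the number of members of $\mathcal{I}^r(G)$ containing the vertex $v$. A family of sets is intersecting if every two of its members intersect. $G$ is called $r$-EKR if, letting $\mathcal{F}\subseteq \mathcal{I}^r(G)$ be an intersecting subfamily of maximum size, some vertex $v$ satisfies $s_r(v)=|\mathcal{F}|$. *)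

(* Defs.v *)
From HB Require Import structures.
From mathcomp Require Import all_boot all_order all_algebra.
From mathcomp Require Import reals exp.

Set Implicit Arguments.
Unset Strict Implicit.
Unset Printing Implicit Defensive.

(* A finite simple graph is a symmetric, irreflexive relation on a finType. *)
Definition simple_graph (T : finType) (e : rel T) : Prop :=
  symmetric e /\ irreflexive e.

Definition degree (T : finType) (e : rel T) (x : T) : nat :=
  #|[set y | e x y]|.

Definition split_vertex (T : finType) (e : rel T) (x : T) : bool :=
  3 <= degree e x.

Definition leaf (T : finType) (e : rel T) (x : T) : bool :=
  degree e x == 1.

Definition connected_graph (T : finType) (e : rel T) : Prop :=
  0 < #|T| /\ forall x y : T, connect e x y.

(* [ucycle e] also holds of [::] and of [:: x; y] for an edge xy, which are
   not cycles of a simple graph; hence the length condition. *)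
Definition acyclic_graph (T : finType) (e : rel T) : Prop :=
  forall c : seq T, 3 <= size c -> ~ ucycle e c.

Definition is_tree (T : finType) (e : rel T) : Prop :=
  [/\ simple_graph e, connected_graph e & acyclic_graph e].

Definition is_dist (T : finType) (e : rel T) (x y : T) (d : nat) : Prop :=
  (exists p : seq T, [/\ path e x p, last x p = y & size p = d]) /\
  (forall p : seq T, path e x p -> last x p = y -> d <= size p).

Definition is_spider (T : finType) (e : rel T) : Prop :=
  is_tree e /\ #|[set x | split_vertex e x]| = 1.

(* S = S(l_0, ..., l_(k-1)) with split vertex w, where v lists the leaves of S
   without repetition. *)
Definition spider_with (T : finType) (e : rel T) (k : nat)
    (l : 'I_k -> nat) (w : T) (v : 'I_k -> T) : Prop :=
  [/\ is_spider e, split_vertex e w, injective v,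
      (forall x : T, leaf e x <-> exists i : 'I_k, v i = x)
    & forall i : 'I_k, is_dist e w (v i) (l i)].

Definition independent (T : finType) (e : rel T) (A : {set T}) : bool :=
  [forall x in A, forall y in A, ~~ e x y].

Definition indep_sets (T : finType) (e : rel T) (r : nat) : {set {set T}} :=
  [set A | independent e A & #|A| == r].

Definition star_size (T : finType) (e : rel T) (r : nat) (x : T) : nat :=
  #|[set A in indep_sets e r | x \in A]|.

Definition intersecting (T : finType) (F : {set {set T}}) : Prop :=
  forall A B : {set T}, A \in F -> B \in F -> A :&: B != set0.

Definition max_intersecting (T : finType) (e : rel T) (r : nat)
    (F : {set {set T}}) : Prop :=
  [/\ F \subset indep_sets e r, intersecting F
    & forall F' : {set {set T}},
        F' \subset indep_sets e r -> intersecting F' -> #|F'| <= #|F|].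

Definition is_EKR (T : finType) (e : rel T) (r : nat) : Prop :=
  forall F : {set {set T}}, max_intersecting e r F ->
    exists x : T, star_size e r x = #|F|.

(* Main.v *)
Require Import Defs.
From HB Require Import structures.
From mathcomp Require Import all_boot all_order all_algebra.
From mathcomp Require Import reals exp.
From mathcomp Require Import zify ring lra.

(** The theorem needs of S only that it is acyclic.  A maximum intersecting
    family F of independent r-sets that is not contained in a star has, by the
    Hilton-Milner theorem for arbitrary r-sets, at most
    C(n-1,r-1) - C(n-r-1,r-1) + 1 members.  On the other hand a forest on m
    vertices has at least C(m-t+1,t) independent t-sets (the path being the
    extremal case), so the star at a vertex of degree at most 1 has at least
    C(n-r,r-1) members.  The bound on r gives r(r-1)/(n-2r+1) <= ln 2, and
    1 + x <= exp x turns this into C(n-1,r-1) <= 2 C(n-r-1,r-1), so the star is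
    at least as large as F.

    Hilton-Milner is proved by induction on the ground set, after replacing a
    fixed point z by other points as long as possible (shifting).  If a shift
    by j produces a star then every member of F meets {z, j}, and the bound
    reduces to one on two cross-intersecting families. *)

(** * Links, deletions and shifts of families of finite sets *)

Section SetFamilies.
Context {T : finType}.
Implicit Types (A B X Y : {set T}) (F G : {set {set T}}) (x z j : T).

Definition ksubsets X k : {set {set T}} :=
  [set A : {set T} | A \subset X & #|A| == k].

Definition cross_intersecting F G :=
  forall A B, A \in F -> B \in G -> A :&: B != set0.

Definition nonstar F := forall x, exists2 A, A \in F & x \notin A.

Definition link F z : {set {set T}} :=
  [set A :\ z | A in [set A in F | z \in A]].

Definition deletion F z : {set {set T}} := [set A in F | z \notin A].

Definition swap z j A := j |: A :\ z.

(** The last condition keeps swapped sets away from the members of [F]; this makes the map behind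
    [shift] injective on [F]. *)
Definition swappable F z j A :=
  [&& z \in A, j \notin A & swap z j A \notin F].

Definition shift F z j : {set {set T}} :=
  [set (if swappable F z j A then swap z j A else A) | A in F].

Definition stable X F z :=
  [forall A in F, forall j in X,
    (z \in A) ==> (j \notin A) ==> (swap z j A \in F)].

Lemma ksubsetsP X k A : reflect (A \subset X /\ #|A| = k) (A \in ksubsets X k).
Proof. by rewrite inE; apply: (iffP andP) => -[-> /eqP]. Qed.

Lemma sub_ksubsets {F X k A} :
  F \subset ksubsets X k -> A \in F -> A \subset X /\ #|A| = k.
Proof. by move=> /subsetP FX /FX/ksubsetsP. Qed.

Lemma card_sub_ksubsets F X k : F \subset ksubsets X k -> #|F| <= 'C(#|X|, k).
Proof. by move=> /subset_leq_card; rewrite cards_draws. Qed.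

Lemma linkP F z B :
  reflect (exists A, [/\ A \in F, z \in A & B = A :\ z]) (B \in link F z).
Proof.
apply: (iffP imsetP) => [[A]|[A [AF zA ->]]].
  by rewrite inE => /andP[AF zA] ->; exists A.
by exists A; rewrite // inE AF.
Qed.

Lemma card_link F z : #|link F z| = #|[set A in F | z \in A]|.
Proof.
apply: card_in_imset => A B; rewrite !inE => /andP[_ zA] /andP[_ zB] E.
by rewrite -(setD1K zA) E setD1K.
Qed.

Lemma card_link_deletion F z : #|F| = #|link F z| + #|deletion F z|.
Proof.
rewrite card_link -(cardsID [set A : {set T} | z \in A] F).
by congr (_ + _); apply: eq_card => A; rewrite !inE andbC.
Qed.

Lemma link_ksubsets F X k z : F \subset ksubsets X k.+1 ->
  link F z \subset ksubsets (X :\ z) k.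
Proof.
move=> FX; apply/subsetP => B /linkP[A [AF zA ->]]; apply/ksubsetsP.
have [AX cA] := sub_ksubsets FX AF.
by split; [exact: setSD | move: cA; rewrite (cardsD1 z) zA => -[]].
Qed.

Lemma deletion_ksubsets F X k z : F \subset ksubsets X k ->
  deletion F z \subset ksubsets (X :\ z) k.
Proof.
move=> FX; apply/subsetP => A; rewrite inE => /andP[AF zA]; apply/ksubsetsP.
by have [AX cA] := sub_ksubsets FX AF; split=> //; rewrite subsetD1 AX.
Qed.

Lemma swapK A z j : z \in A -> j \notin A -> swap j z (swap z j A) = A.
Proof.
move=> zA jA; apply/setP => y; rewrite !inE.
case: (eqVneq y z) => [->|] //; case: (eqVneq y j) => [->|] //= _.
by rewrite (negPf jA).
Qed.

Lemma swap_ksubsets X k A z j : z \in A -> j \notin A -> j \in X ->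
  A \in ksubsets X k -> swap z j A \in ksubsets X k.
Proof.
move=> zA jA jX /ksubsetsP[AX cA]; apply/ksubsetsP; split.
  by rewrite subUset sub1set jX (subset_trans (subsetDl _ _)).
by rewrite cardsU1 !inE (negPf jA) andbF -cA (cardsD1 z A) zA.
Qed.

Lemma notin_swap A z j : z \in A -> j \notin A -> z \notin swap z j A.
Proof. by move=> zA jA; rewrite !inE eqxx orbF; apply: contraNneq jA => <-. Qed.

Lemma shiftP F z j B :
  reflect ((B \in F /\ ~~ swappable F z j B) \/
           exists A, [/\ A \in F, swappable F z j A & B = swap z j A])
          (B \in shift F z j).
Proof.
apply: (iffP imsetP) => [[A AF ->]|[[BF nB]|[A [AF sA ->]]]].
- by case: ifPn => sA; [right; exists A | left].
- by exists B => //; rewrite (negPf nB).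
- by exists A => //; rewrite sA.
Qed.

Lemma card_shift F z j : #|shift F z j| = #|F|.
Proof.
apply: card_in_imset => A B AF BF.
case: ifPn => [/and3P[zA jA nA]|_]; case: ifPn => [/and3P[zB jB nB]|_] // E.
- by rewrite -(swapK _ _ _ zA jA) E swapK.
- by rewrite E BF in nA.
- by rewrite -E AF in nB.
Qed.

Lemma shift_ksubsets F X k z j : j \in X ->
  F \subset ksubsets X k -> shift F z j \subset ksubsets X k.
Proof.
move=> jX /subsetP FX; apply/subsetP => B.
move=> /shiftP[[/FX //]|[A [/FX AX /and3P[zA jA _] ->]]].
exact: swap_ksubsets.
Qed.

(** The delicate case is [z \in B] and [j \notin B]. Then [B] stays in place because [swap z j B] is
    already in [G], and a point common to [A] and that set is neither [j] nor [z], so it survives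
    the swap of [A]. *)
Lemma swap_meets G z j A B :
  (forall C, C \in G -> A :&: C != set0) -> B \in G -> ~~ swappable G z j B ->
  j \notin A -> swap z j A :&: B != set0.
Proof.
move=> AG BG nsB jA; have [jB|jB] := boolP (j \in B).
  by apply/set0Pn; exists j; rewrite !inE eqxx jB.
have [zB|zB] := boolP (z \in B); last first.
  have /set0Pn[y] := AG _ BG; rewrite inE => /andP[yA yB].
  by apply/set0Pn; exists y; rewrite !inE yA yB (memPn zB) ?orbT.
move: nsB; rewrite /swappable zB jB /= negbK => /AG /set0Pn[y].
rewrite !inE => /andP[yA /orP[/eqP yj|/andP[yz yB]]].
  by rewrite -yj yA in jA.
by apply/set0Pn; exists y; rewrite !inE yz yA yB orbT.
Qed.

Lemma shift_cross F G z j : cross_intersecting F G ->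
  cross_intersecting (shift F z j) (shift G z j).
Proof.
move=> FG A' B' /shiftP[[AF nA]|[A [AF sA ->]]] /shiftP[[BG nB]|[B [BG sB ->]]].
- exact: FG.
- rewrite setIC; case/and3P: sB => _ jB _; apply: (swap_meets F) => // C CF.
  by rewrite setIC; exact: FG.
- by case/and3P: sA => _ jA _; apply: (swap_meets G) => // C; exact: FG.
- by apply/set0Pn; exists j; rewrite !inE eqxx.
Qed.

Lemma shift_link_sub F z j :
  [set A in shift F z j | z \in A] \subset [set A in F | z \in A].
Proof.
apply/subsetP => B; rewrite !inE => /andP[/shiftP[[-> _] //|]].
by move=> [A [_ /and3P[zA jA _] ->]]; rewrite (negPf (notin_swap _ _ _ zA jA)).
Qed.

Lemma leq_card_link_shift F z j : #|link (shift F z j) z| <= #|link F z|.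
Proof. by rewrite !card_link subset_leq_card ?shift_link_sub. Qed.

Lemma ltn_card_link_shift F z j A : A \in F -> swappable F z j A ->
  #|link (shift F z j) z| < #|link F z|.
Proof.
move=> AF sA; rewrite !card_link proper_card //; apply/properP.
split; first exact: shift_link_sub.
have /and3P[zA jA _] := sA; exists A; rewrite !inE ?AF ?zA //= andbT.
apply/shiftP => -[[_ /negP//]|[B [_ /and3P[zB jB _] E]]].
by rewrite E (negPf (notin_swap _ _ _ zB jB)) in zA.
Qed.

Lemma stableP X F z :
  reflect (forall A j, A \in F -> j \in X -> z \in A -> j \notin A ->
             swap z j A \in F) (stable X F z).
Proof.
apply: (iffP 'forall_in_forall_inP) => H A.
  by move=> j AF jX zA jA; move: (H A AF j jX); rewrite zA jA.
by move=> AF j jX; apply/implyP => zA; apply/implyP => jA; exact: H.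
Qed.

Lemma unstableP X F z : ~~ stable X F z ->
  exists A j, [/\ A \in F, j \in X & swappable F z j A].
Proof.
rewrite negb_forall_in => /exists_inP[A AF].
rewrite negb_forall_in => /exists_inP[j jX].
by rewrite !negb_imply => sA; exists A, j.
Qed.

(** Both families are shifted by the same [j], which keeps them cross-intersecting. Each shift at a
    swappable member strictly lowers [#|link F z| + #|link G z|], so the process ends. *)
Lemma stabilize F G X k z :
  F \subset ksubsets X k -> G \subset ksubsets X k -> cross_intersecting F G ->
  exists F' G', [/\ F' \subset ksubsets X k /\ G' \subset ksubsets X k,
    cross_intersecting F' G', #|F'| = #|F| /\ #|G'| = #|G|,
    stable X F' z & stable X G' z].
Proof.
have [m] := ubnP (#|link F z| + #|link G z|).
elim: m F G => // m IH F G le_m FX GX FG.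
have [sF|/unstableP[A [j [AF jX sA]]]] := boolP (stable X F z); first last.
  have [| | | |F' [G' [? ? [cF cG] ? ?]]] := IH (shift F z j) (shift G z j).
  - have := ltn_card_link_shift _ _ _ _ AF sA.
    by have := leq_card_link_shift G z j; lia.
  - exact: shift_ksubsets.
  - exact: shift_ksubsets.
  - exact: shift_cross.
  by exists F', G'; rewrite cF cG !card_shift.
have [sG|/unstableP[A [j [AG jX sA]]]] := boolP (stable X G z); first last.
  have [| | | |F' [G' [? ? [cF cG] ? ?]]] := IH (shift F z j) (shift G z j).
  - have := ltn_card_link_shift _ _ _ _ AG sA.
    by have := leq_card_link_shift F z j; lia.
  - exact: shift_ksubsets.
  - exact: shift_ksubsets.
  - exact: shift_cross.
  by exists F', G'; rewrite cF cG !card_shift.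
by exists F, G.
Qed.

(* If A and B met only in z, the hypothesis 2k <= #|X| would leave room to swap
   z out of A for a point outside A and B. *)
Lemma link_cross F G X k z : F \subset ksubsets X k -> G \subset ksubsets X k ->
  cross_intersecting F G -> stable X F z -> 2 * k <= #|X| ->
  cross_intersecting (link F z) (link G z).
Proof.
move=> FX GX FG /stableP sF kX _ _ /linkP[A [AF zA ->]] /linkP[B [BG zB ->]].
have [AX cA] := sub_ksubsets FX AF; have [BX cB] := sub_ksubsets GX BG.
apply/negP => /eqP AB0.
have nAB y : y \in A -> y \in B -> y = z.
  move=> yA yB; apply/eqP; apply: contraT => yz.
  by have := in_set0 y; rewrite -AB0 !inE yz yA yB.
have [j jX] : exists2 j, j \in X & j \notin A :|: B.
  apply/subsetPn; apply: contraTN kX => /subset_leq_card.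
  have : 0 < #|A :&: B| by rewrite card_gt0; exact: FG.
  by have := cardsUI A B; rewrite cA cB; lia.
rewrite inE negb_or => /andP[jA jB].
have /set0Pn[y] := FG _ _ (sF _ _ AF jX zA jA) BG.
rewrite !inE => /andP[/orP[/eqP-> |/andP[/eqP yz yA]]].
  by rewrite (negPf jB).
by move=> /(nAB _ yA).
Qed.

(** * Cross-intersecting families *)

(** The second binomial coefficient counts the k-subsets of [X :\: B], none of which can be in
    [F]. *)
Lemma meeting_bound F X k B : F \subset ksubsets X k -> B \subset X ->
  (forall A, A \in F -> A :&: B != set0) ->
  #|F| + 'C(#|X| - #|B|, k) <= 'C(#|X|, k).
Proof.
move=> FX BX FB; rewrite -(cardsDS BX) -!cards_draws -/(ksubsets _ _).
rewrite -cardsUI (_ : F :&: _ = set0) ?cards0 ?addn0.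
  apply/subset_leq_card; rewrite subUset FX; apply/subsetP => A.
  rewrite !inE => /andP[/subset_trans->] //; exact: subsetDl.
apply/setP => A; rewrite !inE; apply/negP => /andP[/FB + /andP[]].
by rewrite subsetD setI_eq0 => /negPf-> /andP[].
Qed.

(** Complements in [X] are again k-sets here, and the complement of a member of [F] is disjoint from
    that member, hence not in [G]. *)
Lemma cross_half_bound F G X k : F \subset ksubsets X k ->
  G \subset ksubsets X k -> cross_intersecting F G -> #|X| = 2 * k ->
  #|F| + #|G| <= 'C(#|X|, k).
Proof.
move=> FX GX FG cX; pose FC := [set X :\: A | A in F].
have cFC : #|FC| = #|F|.
  apply: card_in_imset => A B AF BF E.
  have [AX _] := sub_ksubsets FX AF; have [BX _] := sub_ksubsets FX BF.
  have DDK C : X :&: C = X :\: (X :\: C) by rewrite setDDr setDv set0U.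
  by rewrite -(setIidPr AX) -(setIidPr BX) !DDK E.
rewrite -cFC -cardsUI (_ : FC :&: G = set0) ?cards0 ?addn0.
  apply: card_sub_ksubsets; rewrite subUset GX andbT.
  apply/subsetP => _ /imsetP[A AF ->]; have [AX cA] := sub_ksubsets FX AF.
  by apply/ksubsetsP; rewrite subsetDl cardsDS // cX cA; split=> //; lia.
apply/setP => B; rewrite !inE; apply/negP.
move=> /andP[/imsetP[A AF ->] /(FG _ _ AF)].
by rewrite setIDA setDIl setDv set0I eqxx.
Qed.

(** A single k-set together with all k-sets meeting it gives equality. After stabilizing at a point
    [z], Pascal's rule splits the bound into one for the deletions and one for the links, both over
    [X :\ z]. *)
Theorem cross_intersecting_bound F G X k : 2 * k <= #|X| ->
  F \subset ksubsets X k -> G \subset ksubsets X k -> F != set0 -> G != set0 ->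
  cross_intersecting F G ->
  #|F| + #|G| + 'C(#|X| - k, k) <= 'C(#|X|, k) + 1.
Proof.
have [m] := ubnP #|X|; elim: m X k F G => // m IH X k F G.
move=> ltXm kX FX GX F0 G0 FG.
have [cX|ncX] := eqVneq #|X| (2 * k).
  have := cross_half_bound _ _ _ _ FX GX FG cX.
  by rewrite (_ : #|X| - k = k) ?binn; lia.
case: k => [|k] in kX ncX FX GX *.
  have [A AF] := set0Pn _ F0; have [B BG] := set0Pn _ G0.
  have [_ /eqP] := sub_ksubsets FX AF; rewrite cards_eq0 => /eqP A0.
  by have := FG _ _ AF BG; rewrite A0 set0I eqxx.
have [z zX] : exists z, z \in X by apply/set0Pn; rewrite -card_gt0; lia.
have [F' [G' [[FX' GX'] FG' [cF cG] sF sG]]] := stabilize _ _ _ _ z FX GX FG.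
rewrite -cF -cG; move: F0 G0; rewrite -!card_gt0 -cF -cG !card_gt0.
move: F' G' FX' GX' FG' sF sG {F G FX GX FG cF cG} => F G FX GX FG sF sG F0 G0.
have cXz : #|X| = #|X :\ z|.+1 by rewrite (cardsD1 z) zX.
have deletion_neq0 (H : {set {set T}}) :
    H \subset ksubsets X k.+1 -> stable X H z -> H != set0 ->
    deletion H z != set0.
  move=> HX /stableP sH /set0Pn[A AH]; apply/set0Pn.
  have [zA|zA] := boolP (z \in A); last by exists A; rewrite inE AH.
  have [AX cA] := sub_ksubsets HX AH.
  have [j jX jA] : exists2 j, j \in X & j \notin A.
    by apply/subsetPn; apply: contraTN kX => /subset_leq_card; lia.
  by exists (swap z j A); rewrite inE sH //= notin_swap.
(* A member of [H] avoiding [z] must meet every member of the link of [K]. This settles the cases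
   where one of the two links is empty. *)
have meeting (H K : {set {set T}}) :
    H \subset ksubsets X k.+1 -> K \subset ksubsets X k.+1 ->
    stable X H z -> H != set0 -> cross_intersecting H K ->
    #|link K z| + 'C(#|X :\ z| - k.+1, k) <= 'C(#|X :\ z|, k).
  move=> HX KX sH H0 HK; have /set0Pn[B BD] := deletion_neq0 _ HX sH H0.
  have [BX <-] := sub_ksubsets (deletion_ksubsets _ _ _ z HX) BD.
  apply: meeting_bound => //; first exact: link_ksubsets.
  move: BD; rewrite inE => /andP[BH zB] _ /linkP[A [AK zA ->]].
  have /set0Pn[y] := HK _ _ BH AK; rewrite inE => /andP[yB yA].
  by apply/set0Pn; exists y; rewrite !inE yB yA (memPn zB).
have IHd : #|deletion F z| + #|deletion G z| + 'C(#|X :\ z| - k.+1, k.+1)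
           <= 'C(#|X :\ z|, k.+1) + 1.
  apply: IH; rewrite ?deletion_ksubsets ?deletion_neq0 //; try lia.
  by move=> A B; rewrite !inE => /andP[AF _] /andP[BG _]; exact: FG.
rewrite (card_link_deletion F z) (card_link_deletion G z) cXz.
have -> : #|X :\ z|.+1 - k.+1 = (#|X :\ z| - k.+1).+1 by lia.
rewrite !binS.
have [LF0|LF0] := eqVneq (link F z) set0.
  by have := meeting _ _ FX GX sF F0 FG; rewrite LF0 cards0; lia.
have [LG0|LG0] := eqVneq (link G z) set0.
  have GF : cross_intersecting G F.
    by move=> A B AG BF; rewrite setIC; exact: FG.
  by have := meeting _ _ GX FX sG G0 GF; rewrite LG0 cards0; lia.
have LFG : cross_intersecting (link F z) (link G z).
  by apply: link_cross FX GX FG sF _; lia.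
have IHl : #|link F z| + #|link G z| + 'C(#|X :\ z| - k, k)
           <= 'C(#|X :\ z|, k) + 1.
  by apply: IH; rewrite ?link_ksubsets //; lia.
(* For [k = 0] the links could contain only the empty set, against [LFG]. *)
case: k => [|k] in FX GX kX ncX IHd IHl meeting deletion_neq0 *.
  have [A AF] := set0Pn _ LF0; have [B BG] := set0Pn _ LG0.
  have [_ /eqP] := sub_ksubsets (link_ksubsets _ _ _ z FX) AF.
  by rewrite cards_eq0 => /eqP A0; have := LFG _ _ AF BG; rewrite A0 set0I eqxx.
(* The two induction hypotheses each carry a summand 1. One of them is absorbed by the positive term
   that Pascal's rule splits off below. *)
move: IHl; have -> : #|X :\ z| - k.+1 = (#|X :\ z| - k.+2).+1 by lia.
rewrite binS; have : 0 < 'C(#|X :\ z| - k.+2, k) by rewrite bin_gt0; lia.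
by lia.
Qed.

(** * Intersecting families without a common point *)

(** A member avoiding a point [x] of [A] still meets [A], so [A] has a second point. *)
Lemma nonstar_gt1 F X k : F \subset ksubsets X k -> intersecting F ->
  nonstar F -> F != set0 -> 1 < k.
Proof.
move=> FX FF nF /set0Pn[A AF]; have [_ cA] := sub_ksubsets FX AF.
have /set0Pn[x xA] : A != set0 by rewrite -[A]setIid; exact: FF.
have [B BF xB] := nF x; rewrite -cA; apply/card_gt1P.
have /set0Pn[y] := FF _ _ AF BF; rewrite inE => /andP[yA yB].
by exists x, y; split=> //; apply: contraNneq xB => ->.
Qed.

Lemma star_meeting_bound F X k x B : F \subset ksubsets X k.+1 -> x \in X ->
  (forall A, A \in F -> x \in A) -> B \subset X -> x \notin B ->
  (forall A, A \in F -> A :&: B != set0) ->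
  #|F| + 'C(#|X|.-1 - #|B|, k) <= 'C(#|X|.-1, k).
Proof.
move=> FX xX Fx BX xB FB.
have -> : #|F| = #|link F x|.
  rewrite card_link; apply: eq_card => A; rewrite !inE.
  by case: (boolP (A \in F)) => // /Fx->.
have -> : #|X|.-1 = #|X :\ x| by rewrite (cardsD1 x X) xX.
apply: meeting_bound; rewrite ?link_ksubsets ?subsetD1 ?BX //.
move=> _ /linkP[A [AF _ ->]]; have /set0Pn[y] := FB _ AF.
rewrite inE => /andP[yA yB].
by apply/set0Pn; exists y; rewrite !inE yA yB (memPn xB).
Qed.

(** Members containing both [z] and [j] are counted trivially. Those containing exactly one of them
    leave two families on [X] without [z] and [j]: nonempty because [F] is no star, and
    cross-intersecting because a point common to both kinds is neither [z] nor [j]. *)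
Lemma two_cover_bound F X k z j : z \in X -> j \in X -> z != j ->
  2 * k.+2 <= #|X| -> F \subset ksubsets X k.+2 ->
  intersecting F -> nonstar F ->
  (forall A, A \in F -> (z \in A) || (j \in A)) ->
  #|F| + 'C(#|X| - k.+3, k.+1) <= 'C(#|X|.-1, k.+1) + 1.
Proof.
move=> zX jX zj kX FX FF nF Fzj; pose Y := (X :\ j) :\ z.
have cY : #|X| = #|Y|.+2.
  by rewrite (cardsD1 j X) jX (cardsD1 z (X :\ j)) !inE zj zX.
pose Fj := deletion (link F j) z; pose Fz := link (deletion F j) z.
have cF : #|F| = #|link (link F j) z| + #|Fj| + #|Fz|.
  rewrite (card_link_deletion F j) (card_link_deletion (link F j) z).
  congr (_ + _); rewrite card_link; apply: eq_card => A; rewrite !inE.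
  case: (boolP (A \in F)) => //= AF; have := Fzj _ AF.
  by case: (z \in A); case: (j \in A).
have le_zj : #|link (link F j) z| <= 'C(#|Y|, k).
  by apply: card_sub_ksubsets; do 2 apply: link_ksubsets.
have : #|Fj| + #|Fz| + 'C(#|Y| - k.+1, k.+1) <= 'C(#|Y|, k.+1) + 1.
  apply: cross_intersecting_bound.
  - by lia.
  - by apply: deletion_ksubsets; apply: link_ksubsets.
  - by apply: link_ksubsets; apply: deletion_ksubsets.
  - have [A AF zA] := nF z; have := Fzj _ AF; rewrite (negPf zA) /= => jA.
    apply/set0Pn; exists (A :\ j); rewrite inE !inE (negPf zA) andbF andbT.
    by apply/linkP; exists A.
  - have [A AF jA] := nF j; have := Fzj _ AF; rewrite (negPf jA) orbF => zA.
    by apply/set0Pn; exists (A :\ z); apply/linkP; exists A; rewrite inE AF.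
  - move=> A' B'; rewrite inE => /andP[/linkP[A [AF jA ->]] zA].
    move=> /linkP[B [+ zB ->]]; rewrite inE => /andP[BF jB].
    have /set0Pn[y] := FF _ _ AF BF; rewrite inE => /andP[yA yB].
    have yj := memPn jB _ yB.
    apply/set0Pn; exists y; rewrite !inE yj yA yB /= andbT.
    by apply: contraNneq zA => <-; rewrite !inE yj.
by rewrite cF cY succnK binS !subSS; lia.
Qed.

(** The outer induction is on [#|X|], the inner one on the number of members through [z]. By
    conversion, [intersecting F] is [cross_intersecting F F], so the lemmas on pairs of families
    apply. *)
Theorem Hilton_Milner F X k : 2 * k.+1 <= #|X| -> F \subset ksubsets X k.+1 ->
  intersecting F -> nonstar F ->
  #|F| + 'C(#|X| - k.+2, k) <= 'C(#|X|.-1, k) + 1.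
Proof.
have [m] := ubnP #|X|; elim: m X k F => // m IH X k F ltXm kX FX FF nF.
have [F0|F0] := eqVneq F set0.
  by rewrite F0 cards0; apply: leq_trans (leq_bin2l _ _) (leq_addr _ _); lia.
have [z zX] : exists z, z \in X by apply/set0Pn; rewrite -card_gt0; lia.
have [p] := ubnP #|link F z|; elim: p F FX FF nF F0 => // p IHp F.
move=> FX FF nF F0 ltLp.
have k_gt0 := nonstar_gt1 _ _ _ FX FF nF F0.
case: k => // k in FX kX k_gt0 IHp *.
have [sF|/unstableP[A [j [AF jX sA]]]] := boolP (stable X F z); first last.
  have /and3P[zA jA _] := sA.
  have zj : z != j by apply: contraNneq jA => <-.
  have [/forallP nS|] :=
    boolP [forall x, exists A, (A \in shift F z j) && (x \notin A)].
    rewrite -(card_shift F z j); apply: IHp.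
    - exact: shift_ksubsets.
    - exact: shift_cross.
    - by move=> x; have /existsP[B /andP[]] := nS x; exists B.
    - by rewrite -card_gt0 card_shift card_gt0.
    - by have := ltn_card_link_shift _ _ _ _ AF sA; lia.
  rewrite negb_forall => /existsP[x]; rewrite negb_exists => /forallP Sx.
  (* The shifted family is a star at [x]. A member of [F] can miss [x] only if its swap brought [x]
     in, that is, if [x] is [j]; since some member does miss [x], all members meet [{z, j}]. *)
  have Fx B : B \in F -> (x \in B) || (z \in B) && (x == j).
    move=> BF; have := Sx (if swappable F z j B then swap z j B else B).
    rewrite imset_f //= negbK; case: ifP => [/and3P[-> _ _]|_ -> //].
    by rewrite !inE => /orP[->|/andP[_ ->]]; rewrite ?orbT.
  have [B BF xB] := nF x; have := Fx B BF.
  rewrite (negPf xB) => /andP[_ /eqP xj].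
  apply: (two_cover_bound _ _ _ z j) => // C /Fx.
  by rewrite xj eqxx andbT orbC.
have {IHp ltLp p} cXz : #|X| = #|X :\ z|.+1 by rewrite (cardsD1 z) zX.
(* Pairing [F] with itself bounds [2 * #|F|] by the central binomial coefficient, which is twice
   C(|X| - 1, k + 1). *)
have [cX|ncX] := eqVneq #|X| (2 * k.+2).
  have := cross_half_bound _ _ _ _ FX FX FF cX.
  rewrite cX (_ : (2 * k.+2).-1 = (k.+1 + k.+2)); last by lia.
  rewrite (_ : 2 * k.+2 - k.+3 = k.+1); last by lia.
  rewrite binn (_ : 2 * k.+2 = (k.+1 + k.+2).+1); last by lia.
  by rewrite binS -{1}(@bin_sub _ k.+2) ?leq_addl // addnK; lia.
have nD : nonstar (deletion F z).
  move=> x; have [A AF xA] := nF x; have [AX cA] := sub_ksubsets FX AF.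
  have [zA|zA] := boolP (z \in A); last by exists A; rewrite // inE AF.
  (* Choosing [j] different from [x] as well makes the swapped set avoid both [z] and [x]. *)
  have [j jX] : exists2 j, j \in X & j \notin x |: A.
    apply/subsetPn; apply: contraTN kX => /subset_leq_card.
    by rewrite cardsU1 xA cA; lia.
  rewrite !inE negb_or => /andP[jx jA].
  exists (swap z j A); first by rewrite inE (stableP _ _ _ sF) //= notin_swap.
  by rewrite !inE (negPf xA) andbF orbF eq_sym.
have IHd : #|deletion F z| + 'C(#|X :\ z| - k.+3, k.+1)
           <= 'C(#|X :\ z|.-1, k.+1) + 1.
  apply: IH; rewrite ?deletion_ksubsets //; try lia.
  by move=> A B; rewrite !inE => /andP[AF _] /andP[BF _]; exact: FF.
rewrite (card_link_deletion F z) cXz succnK.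
have -> : #|X :\ z|.+1 - k.+3 = (#|X :\ z| - k.+3).+1 by lia.
have -> : 'C(#|X :\ z|, k.+1) = 'C(#|X :\ z|.-1, k.+1) + 'C(#|X :\ z|.-1, k).
  by rewrite -binS prednK //; lia.
rewrite binS.
(* The summand 1 of the goal is used up by [IHd], so the link has to satisfy its share of the bound
   without it. *)
have LX := link_ksubsets F X _ z FX.
have LL : intersecting (link F z).
  by apply: (link_cross _ _ _ _ _ FX FX FF sF); lia.
have [L0|L0] := eqVneq (link F z) set0.
  have : 'C(#|X :\ z| - k.+3, k) <= 'C(#|X :\ z|.-1, k).
    by apply: leq_bin2l; lia.
  by rewrite L0 cards0; lia.
have [/forallP nL|] :=
  boolP [forall x, exists A, (A \in link F z) && (x \notin A)].
  have {}nL : nonstar (link F z).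
    by move=> x; have /existsP[B /andP[]] := nL x; exists B.
  have := nonstar_gt1 _ _ _ LX LL nL L0.
  case: k => // k in FX kX k_gt0 ncX IHd LX *.
  have : #|link F z| + 'C(#|X :\ z| - k.+3, k.+1) <= 'C(#|X :\ z|.-1, k.+1) + 1.
    by apply: IH => //; lia.
  have -> : #|X :\ z| - k.+3 = (#|X :\ z| - k.+4).+1 by lia.
  rewrite binS; have : 0 < 'C(#|X :\ z| - k.+4, k) by rewrite bin_gt0; lia.
  by lia.
rewrite negb_forall => /existsP[x]; rewrite negb_exists => /forallP Lx.
have {}Lx A : A \in link F z -> x \in A.
  by move=> AL; have := Lx A; rewrite AL negbK.
(* The link is a star at [x], and [B], which avoids [z] and [x], meets all its members; this yields
   the bound without the summand 1. *)
have [B BD xB] := nD x.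
have [BX cB] := sub_ksubsets (deletion_ksubsets _ _ _ z FX) BD.
have xX : x \in X :\ z.
  have [A AL] := set0Pn _ L0; have [AX _] := sub_ksubsets LX AL.
  exact: (subsetP AX) (Lx _ AL).
have : #|link F z| + 'C(#|X :\ z|.-1 - #|B|, k) <= 'C(#|X :\ z|.-1, k).
  apply: (star_meeting_bound _ _ _ x) => // _ /linkP[A [AF zA ->]].
  move: BD; rewrite inE => /andP[BF zB].
  have /set0Pn[y] := FF _ _ AF BF; rewrite inE => /andP[yA yB].
  by apply/set0Pn; exists y; rewrite !inE yA yB (memPn zB).
rewrite cB (_ : #|X :\ z|.-1 - k.+2 = #|X :\ z| - k.+3); lia.
Qed.

End SetFamilies.

(** * Independent sets in forests *)

Section Forests.
Variables (T : finType) (e : rel T).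
Hypotheses (e_sym : symmetric e) (e_irr : irreflexive e).
Hypothesis e_acyclic : acyclic_graph e.
Implicit Types (U A : {set T}) (x y v : T) (p : seq T).

Definition nbrs U v := [set y in U | e v y].

Definition indep_subsets U t := [set A in indep_sets e t | A \subset U].

(** If [y] occurred further along [p], the segment from [x] to [y] closed by the edge [xy] would be
    a cycle of length at least 3. *)
Lemma path_chord_free x y p : path e x p -> uniq (x :: p) -> e x y ->
  y != head x p -> y \notin p.
Proof.
move=> ep up exy yp; apply/negP => yinp; case/splitPr: yinp ep up yp => p1 p2.
rewrite -cat_rcons cat_path => /andP[ep1 _] /= /andP[xp].
rewrite cat_uniq => /andP[up1 _]; case: p1 ep1 xp up1 => [|z p1].
  by rewrite /= eqxx.
rewrite /= => ep1 xp up1 _; apply: (e_acyclic (x :: z :: rcons p1 y)).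
  by rewrite /= size_rcons.
move: xp; rewrite -cat_cons mem_cat negb_or => /andP[xp _].
rewrite /ucycle /= rcons_path last_rcons (e_sym y) exy andbT xp.
by move: ep1 up1 => /= -> ->.
Qed.

(* With two neighbours in U at every vertex of U, paths inside U could be
   prolonged forever. *)
Lemma acyclic_low_degree U : U != set0 -> exists2 v, v \in U & #|nbrs U v| <= 1.
Proof.
move=> /set0Pn[x0 x0U].
have [/exists_inP[v vU v1]|] := boolP [exists v in U, #|nbrs U v| <= 1].
  by exists v.
rewrite negb_exists_in => /forall_inP deg2.
have long m : exists x p, [/\ path e x p, uniq (x :: p), all [in U] (x :: p)
                            & size p = m].
  elim: m => [|m [x [p [ep up Up sp]]]].
    by exists x0, [::]; rewrite /= x0U.
  have xU : x \in U by case/andP: Up.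
  have [y [yU exy yp]] : exists y, [/\ y \in U, e x y & y != head x p].
    have := deg2 _ xU; rewrite -ltnNge => /card_gt1P[y [y' []]].
    rewrite !inE => /andP[yU exy] /andP[y'U exy'] yy'.
    have [E|] := eqVneq y (head x p); last by exists y.
    by exists y'; rewrite -E eq_sym.
  have ynp := path_chord_free _ _ _ ep up exy yp.
  have yx : y != x by apply: contraTneq exy => ->; rewrite e_irr.
  exists y, (x :: p); split => //=; last by rewrite sp.
  - by rewrite e_sym exy.
  - by rewrite inE negb_or yx ynp.
  - by rewrite yU.
(* Such a path would have [#|T|.+1] distinct vertices. *)
have [x [p [_ up _ sp]]] := long #|T|.
by have := max_card [in x :: p]; rewrite (card_uniqP up) /= sp ltnn.
Qed.

Lemma indep_subsetsP U t A :
  reflect [/\ {in A &, forall x y, ~~ e x y}, #|A| = t & A \subset U]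
          (A \in indep_subsets U t).
Proof.
rewrite !inE; apply: (iffP andP).
  move=> [/andP[/forall_inP iA /eqP cA] AU].
  by split=> // x y xA yA; exact: (forall_inP (iA x xA)).
move=> [iA cA AU]; rewrite cA eqxx AU andbT; split=> //.
by apply/forall_inP => x xA; apply/forall_inP => y; exact: iA.
Qed.

Lemma link_indep_subsets U v t : v \in U ->
  indep_subsets (U :\: (v |: nbrs U v)) t \subset link (indep_subsets U t.+1) v.
Proof.
move=> vU; apply/subsetP => A /indep_subsetsP[iA cA].
rewrite subsetD => /andP[AU]; rewrite disjoint_sym => /disjointFl dA.
have vA : v \notin A by apply/negP => /dA; rewrite !inE eqxx.
have nv y : y \in A -> ~~ e v y.
  move=> yA; have := dA _ yA; rewrite !inE (subsetP AU _ yA) /=.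
  by case: (e v y); rewrite ?orbT.
apply/linkP; exists (v |: A); rewrite !inE eqxx setU1K //; split=> //.
apply/andP; split; last by rewrite subUset sub1set vU.
rewrite cardsU1 vA cA eqxx andbT; apply/forall_inP => x xA.
apply/forall_inP => y yA; move: xA yA; rewrite !inE.
move=> /orP[/eqP->|xA] /orP[/eqP->|yA]; rewrite ?e_irr ?nv //; last exact: iA.
by rewrite e_sym nv.
Qed.

Lemma indep_subsets_deletion U v t :
  indep_subsets (U :\ v) t \subset deletion (indep_subsets U t) v.
Proof.
by apply/subsetP => A; rewrite !inE subsetD1 => /andP[-> /andP[-> ->]].
Qed.

Lemma leq_card_delete_nbrs U v : #|nbrs U v| <= 1 ->
  #|U| - 2 <= #|U :\: (v |: nbrs U v)|.
Proof.
move=> v1; rewrite cardsD leq_sub2l //.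
apply: leq_trans (subset_leq_card (subsetIr _ _)) _.
by rewrite cardsU1; case: (_ \notin _); lia.
Qed.

(** The left side is the exact count for a path. Splitting at a vertex [v] of degree at most 1 in
    [U] mirrors Pascal's rule: sets avoiding [v] live on one vertex fewer, sets containing [v] on at
    most two fewer. *)
Lemma indep_subsets_bound U t : 'C(#|U|.+1 - t, t) <= #|indep_subsets U t|.
Proof.
have [m] := ubnP #|U|; elim: m U t => // m IH U [|t] ltUm.
  rewrite bin0 card_gt0; apply/set0Pn; exists set0; apply/indep_subsetsP.
  by rewrite cards0 sub0set; split=> // x y; rewrite inE.
have [U0|U0] := eqVneq U set0; first by rewrite U0 cards0 subSS sub0n.
have [v vU v1] := acyclic_low_degree _ U0.
have cU : #|U| = #|U :\ v|.+1 by rewrite (cardsD1 v) vU.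
rewrite (card_link_deletion _ v).
have := subset_leq_card (link_indep_subsets U v t vU).
have := subset_leq_card (indep_subsets_deletion U v t.+1).
have := leq_card_delete_nbrs _ _ v1.
set W := U :\: _ => leW.
have ltW : #|W| < #|U|.
  apply: proper_card; rewrite properE subsetDl /=.
  by apply/subsetPn; exists v; rewrite // !inE eqxx.
have IHd : 'C(#|U :\ v|.+1 - t.+1, t.+1) <= #|indep_subsets (U :\ v) t.+1|.
  by apply: IH; lia.
have IHl : 'C(#|W|.+1 - t, t) <= #|indep_subsets W t| by apply: IH; lia.
have leb : 'C(#|U| - t.+1, t) <= 'C(#|W|.+1 - t, t) by apply: leq_bin2l; lia.
(* If [#|U| <= t], the truncated difference is 0 and the left side vanishes. *)
have split : 'C(#|U|.+1 - t.+1, t.+1) <=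
    'C(#|U| - t.+1, t.+1) + 'C(#|U| - t.+1, t).
  have [tU|Ut] := leqP t.+1 #|U|; first by rewrite subSn // binS.
  by rewrite (_ : #|U|.+1 - t.+1 = 0) ?bin0n; lia.
rewrite -cU in IHd; lia.
Qed.

(** Removing [v] and its at most one neighbour leaves at least [#|T| - 2] vertices; each independent
    r-set among them extends by [v]. *)
Lemma leaf_star_bound r : 0 < #|T| ->
  exists v, 'C(#|T| - r.+1, r) <= star_size e r.+1 v.
Proof.
move=> T0; have [|v _ v1] := acyclic_low_degree setT.
  by rewrite -card_gt0 cardsT.
exists v; have := subset_leq_card (link_indep_subsets setT v r (in_setT v)).
have := leq_card_delete_nbrs _ _ v1; rewrite cardsT; set W := _ :\: _ => leW.
rewrite card_link (_ : #|[set A in _ | _]| = star_size e r.+1 v); last first.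
  by apply: eq_card => A; rewrite !inE subsetT andbT.
apply: leq_trans; apply: leq_trans (indep_subsets_bound W r).
by apply: leq_bin2l; lia.
Qed.

End Forests.

(** * Numerical estimates *)

(** A division-free bound of C(a, t) / C(a - t - 1, t) by the t-th power of 1 + (t + 1) / (a - 2t),
    obtained by comparing the falling factorials factor by factor. *)
Lemma leq_bin_ratio a t : 2 * t <= a ->
  'C(a, t) * (a - 2 * t) ^ t <= 'C(a - t.+1, t) * (a - t).+1 ^ t.
Proof.
move=> ta; rewrite -(leq_pmul2r (fact_gt0 t)) mulnAC bin_ffact mulnAC bin_ffact.
have powE x : x ^ t = \prod_(i < t) x by rewrite prod_nat_const card_ord.
rewrite !ffact_prod !powE -!big_split /=.
apply: leq_prod => -[i it] _ /=; pose c := a - 2 * t; pose d := t - i.+1.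
have -> : a - i = c + t.+1 + d by rewrite /c /d; lia.
have -> : a - t.+1 - i = c + d by rewrite /c /d; lia.
have -> : (a - t).+1 = c + t.+1 by rewrite /c; lia.
rewrite mulnDl [in leqRHS]mulnDl -/c (mulnC c) leq_add2l.
by rewrite leq_mul2l leq_addr orbT.
Qed.

Section Numeric.
Import Order.TTheory GRing.Theory Num.Theory.
Local Open Scope ring_scope.
Variable R : realType.

Lemma ln2_gt0 : 0 < ln (2 : R).
Proof. by rewrite ln_gt0 // ltr1n. Qed.

Lemma ln2_lt1 : ln (2 : R) < 1.
Proof.
rewrite -[ltRHS]expRK ltr_ln ?posrE ?expR_gt0 //.
by have := @expR_gt1Dx R 1 (oner_neq0 _); lra.
Qed.

(** Move [ln 2 / 2] to the left, square, and drop the square of [ln 2 / 2]. *)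
Lemma sqr_le_of_le_sqrt (r n : nat) :
  (r%:R <= Num.sqrt (n%:R * ln (2 : R)) - ln (2 : R) / 2 :> R) ->
  r%:R ^+ 2 + r%:R * ln (2 : R) <= n%:R * ln (2 : R).
Proof.
have L0 := ln2_gt0; set L := ln _ in L0 *; rewrite lerBrDr => le_sqrt.
have nL0 : 0 <= n%:R * L by rewrite mulr_ge0 // ltW.
have r0 : 0 <= r%:R :> R by [].
have : (r%:R + L / 2) ^+ 2 <= Num.sqrt (n%:R * L) ^+ 2.
  by rewrite lerXn2r // nnegrE ?sqrtr_ge0 //; lra.
by rewrite sqr_sqrtr //; nra.
Qed.

(** As [r.+2] exceeds [ln 2], the left side of the hypothesis exceeds [2 * r.+2 * ln 2]. *)
Lemma ltn_of_sqr_le (r n : nat) :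
  r.+2%:R ^+ 2 + r.+2%:R * ln (2 : R) <= n%:R * ln (2 : R) ->
  (2 * r.+2 < n)%N.
Proof.
have L0 := ln2_gt0; have L1 := ln2_lt1; set L := ln _ in L0 L1 * => le_n.
have r2 : 2 <= r.+2%:R :> R by rewrite ler_nat.
rewrite -(ltr_nat R) natrM -(ltr_pM2r L0).
by move: (r.+2%:R : R) le_n r2 => s; nra.
Qed.

Lemma bin_half_bound (r n : nat) : (2 * r.+1 < n)%N ->
  r.+1%:R ^+ 2 + r.+1%:R * ln (2 : R) <= n%:R * ln (2 : R) ->
  ('C(n.-1, r) <= 2 * 'C(n - r.+2, r))%N.
Proof.
move=> rn le_n; pose b := (n.-1 - 2 * r)%N.
have b0 : 0 < b%:R :> R by rewrite ltr0n /b; lia.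
have bE : b%:R = n%:R - 2 * r.+1%:R + 1 :> R.
  have : n%:R + 1 = b%:R + 2 * r.+1%:R :> R.
    by rewrite natr1 -natrM -natrD; congr _%:R; rewrite /b; lia.
  by move=> nE; lra.
pose x : R := r.+1%:R / b%:R.
(* After clearing [b] and inserting the lower bound on [n * ln 2], what remains is
   [r * ln 2 <= r + 1]. *)
have xr : x * r%:R <= ln 2.
  have L0 := ln2_gt0; have L1 := ln2_lt1; have r0 : 0 <= r%:R :> R by [].
  rewrite /x mulrAC ler_pdivrMr // bE; rewrite -natr1 in le_n *.
  nra.
have pow2 : (1 + x) ^+ r <= 2.
  have x0 : 0 <= x by rewrite divr_ge0.
  have -> : 2 = sequences.expR (ln 2) :> R by rewrite lnK // posrE.
  apply: le_trans (_ : sequences.expR x ^+ r <= _).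
    by rewrite lerXn2r ?nnegrE ?expR_ge0 ?expR_ge1Dx //; lra.
  by rewrite -expRM_natr ler_expR.
have := @leq_bin_ratio n.-1 r; rewrite -/b.
rewrite (_ : (n.-1 - r).+1 = (b + r.+1)%N); last by rewrite /b; lia.
rewrite (_ : (n.-1 - r.+1 = n - r.+2)%N); last by lia.
move=> /(_ ltac:(lia)); rewrite -(ler_nat R) !natrM !natrX natrD => ratio.
rewrite -(ler_nat R) natrM.
have bpow : 0 < b%:R ^+ r :> R by rewrite exprn_gt0.
rewrite -(ler_pM2r bpow); apply: le_trans ratio _.
rewrite (_ : b%:R + r.+1%:R = (1 + x) * b%:R); last first.
  by rewrite mulrDl mul1r /x divfK // gt_eqF.
rewrite exprMn mulrA ler_pM2r // mulrC.
by rewrite ler_wpM2r.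
Qed.

End Numeric.

Theorem theorem2p4 (R : realType) (T : finType) (e : rel T) (n k : nat)
    (l : 'I_k -> nat) (w : T) (v : 'I_k -> T) (r : nat) :
  spider_with e l w v -> #|T| = n ->
  (0 < r)%N ->
  (r%:R <= Num.sqrt (n%:R * ln (2 : R)) - ln (2 : R) / 2 :> R)%R ->
  is_EKR e r.
Proof.
case=> -[[[e_sym e_irr] [T0 _] e_acyclic] _] _ _ _ _ cT.
move=> r_gt0 /sqr_le_of_le_sqrt le_n.
move=> F [FI FF maxF]; have le_star x : star_size e r x <= #|F|.
  apply: maxF.
    by apply/subsetP => A; rewrite inE => /andP[].
  move=> A B; rewrite !inE => /andP[_ xA] /andP[_ xB].
  by apply/set0Pn; exists x; rewrite inE xA.
have [/forallP nF|] :=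
  boolP [forall x, exists A, (A \in F) && (x \notin A)]; last first.
  rewrite negb_forall => /existsP[x]; rewrite negb_exists => /forallP Fx.
  exists x; apply/eqP; rewrite eqn_leq le_star subset_leq_card //.
  apply/subsetP => A AF; have := Fx A; rewrite AF negbK inE => ->.
  by rewrite (subsetP FI).
have {}nF : nonstar F by move=> x; have /existsP[A /andP[]] := nF x; exists A.
have FX : F \subset ksubsets setT r.
  by apply/subsetP => A /(subsetP FI); rewrite !inE subsetT => /andP[].
have F0 : F != set0.
  by have [x _] := card_gt0P T0; have [A AF _] := nF x; apply/set0Pn; exists A.
have r_gt1 := nonstar_gt1 _ _ _ FX FF nF F0.
(* From here on the independent sets have [r.+2] elements. *)
case: r => [|[|r]] // in le_n le_star FX FI maxF r_gt0 r_gt1 *.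
have rn := ltn_of_sqr_le _ _ _ le_n.
have half := bin_half_bound _ _ _ rn le_n.
have [u le_u] := leaf_star_bound _ _ e_sym e_irr e_acyclic r.+1 T0.
have := Hilton_Milner F setT r.+1; rewrite cardsT cT in le_u *.
move=> /(_ (ltnW rn) FX FF nF) le_F.
(* [le_F] and [half] give [#|F| <= 'C(n - r.+3, r.+1) + 1]. The positive second summand of [binE]
   covers the 1, so [le_u] concludes. *)
have binE : 'C(n - r.+2, r.+1) = 'C(n - r.+3, r.+1) + 'C(n - r.+3, r).
  by rewrite -binS; congr 'C(_, _); lia.
have bin_gt0 : 0 < 'C(n - r.+3, r) by rewrite bin_gt0; lia.
exists u; apply/eqP; rewrite eqn_leq le_star; apply: leq_trans le_u.
by move: le_F; set f := #|F|; lia.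
Qed.
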